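(* Let $X=\{x,y\}$ and let $\sigma\subseteq\overline{\Omega}_X\mathsf S$ be a nonempty set of binary implicit operations such that every $w\in\sigma$ satisfies one of the following properties: (1) either $x^3$ or $y^3$ is a suffix of $w$; (2) each factor of length $4$ of $w$ within bounded distance from the end has two disjoint occurrences in $w$. Suppose further that the pseudovariety of groups $\mathsf H_\sigma=[\![w=1: w\in\sigma]\!]$ has infinite exponent. Let $\mathsf{Ab}$ be the pseudovariety of all finite Abelian groups, and let $\mathsf{CR}(\mathsf H_\sigma)$ be the pseudovariety of all finite completely regular semigroups whose subgroups all belong to $\mathsf H_\sigma$. Then no pseudovariety $\mathsf V$ with $\mathsf H_\sigma\cap\mathsf{Ab}\subseteq\mathsf V\subseteq\mathsf{CR}(\mathsf H_\sigma)$ is $\sigma\cup\{\omega\}$-reducible (for the equation $x=y$), where $\sigma\cup\{\omega\}$ denotes the implicit signature consisting of binary multiplication, the operations in $\sigma$, and the unary $\omega$-power.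
   Context: A pseudovariety of semigroups is a class of finite semigroups closed under taking subsemigroups, homomorphic images and finite direct products. For a finite set $A$, $\overline{\Omega}_A\mathsf S$ denotes the free profinite semigroup on $A$; its elements are called pseudowords, and the free semigroup $A^+$ is a dense subsemigroup. Each $w\in\overline{\Omega}_A\mathsf S$ is interpreted in a profinite semigroup $S$ as the $A$-ary operation $w_S:S^A\to S$, $w_S(\varphi)=\hat\varphi(w)$, where $\hat\varphi:\overline{\Omega}_A\mathsf S\to S$ is the unique continuous homomorphism extending $\varphi:A\to S$; elements of $\overline{\Omega}_A\mathsf S$ are therefore also called $A$-ary implicit operations (binary if $A=\{x,y\}$). For $k\in\mathbb Z$, $x^{\omega+k}=\lim_{n\to\infty}x^{n!+k}$. For $u,v\in\overline{\Omega}_A\mathsf S$, a finite semigroup $S$ satisfies $u=v$ if $u_S=v_S$; $\mathsf V\models u=v$ means every $S\in\mathsf V$ satisfies $u=v$; $[\![\Sigma]\!]$ is the class of all finite semigroups satisfying all pseudoidentities in $\Sigma$. The abbreviation $w=1$ stands for the pair of pseudoidentities $wz=z=zw$, where $z$ is a variable not occurring in $w$ (so $S$ satisfies $w=1$ iff $S$ has an identity element and $w_S$ is constantly equal to it). A pseudovariety has infinite exponent if it satisfies no pseudoidentity of the form $x^{\omega+n}=x^\omega$ with $n$ a positive integer. A finite semigroup is completely regular if it satisfies $x^{\omega+1}=x$. A word $v$ is a suffix of a pseudoword $w$ if $w=w'v$ for some, possibly empty, pseudoword $w'$; $v$ is a factor of $w$ if $w=w'vw''$ with $w',w''$ possibly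 empty pseudowords. A pseudoword $w$ has two disjoint occurrences of $v$ if there is a factorization of $w$ in which $v$ appears twice as a factor, i.e. $w=w_0vw_1vw_2$ with $w_0,w_1,w_2$ possibly empty pseudowords. A word $v$ appears as a factor of $w$ within bounded distance from the end if some finite suffix of $w$ (a suffix that is a word) admits $v$ as a factor. An implicit signature $\tau$ is a set of pseudowords (over finite alphabets) that includes binary multiplication. For a finite set $A$, $\Omega^\tau_A\mathsf S$ is the smallest subset of $\overline{\Omega}_A\mathsf S$ containing $A$ and closed under all operations in $\tau$; its elements are called $\tau$-words. Given a pseudovariety $\mathsf V$, a finite semigroup $S$, elements $s,t\in S$, and an onto continuous homomorphism $\varphi:\overline{\Omega}_A\mathsf S\to S$ with $A$ finite, a $\mathsf V$-solution of the equation $x=y$ for the triple $(S,s,t)$ is a pair $u,v\in\overline{\Omega}_A\mathsf S$ such that $\mathsf V\models u=v$, $\varphi(u)=s$ and $\varphi(v)=t$. The pseudovariety $\mathsf V$ is $\tau$-reducible (for the equation $x=y$) if, whenever there is a $\mathsf V$-solution for a triple $(S,s,t)$, there is a $\mathsf V$-solution $(u,v)$ for it with both $u$ and $v$ $\tau$-words (over the same $A$, with respect to the same $\varphi$). This property is independent of the choice of the onto continuous homomorphism $\varphi$. *)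

(* Defs.v *)
From HB Require Import structures.
From mathcomp Require Import all_boot monoid.
From mathcomp Require Import boolp classical_sets filter topology.
Set Implicit Arguments.
Unset Strict Implicit.
Unset Printing Implicit Defensive.
Local Open Scope classical_set_scope.
Local Open Scope group_scope.

HB.mixin Record isInhabited (T : Type) := { inhabitedT : inhabited T }.

#[short(type="finSemigroupType")]
HB.structure Definition FinSemigroup :=
  {T of Semigroup T & Finite T & isInhabited T}.

Section ProductSemigroup.
Variables S T : finSemigroupType.

Let prod_inhabited : inhabited (S * T).
Proof.
by case: (@inhabitedT S) => s; case: (@inhabitedT T) => t; exact: inhabits (s, t).
Qed.

HB.instance Definition _ := isInhabited.Build (S * T)%type prod_inhabited.

End ProductSemigroup.

Section TrivialSemigroup.

Let unit_mulA : associative (fun _ _ : unit => tt).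
Proof. by []. Qed.

HB.instance Definition _ := isSemigroup.Build unit unit_mulA.
HB.instance Definition _ := isInhabited.Build unit (inhabits tt).

End TrivialSemigroup.

(* The power x^n for n >= 1; by convention spow x 0 = x, as a semigroup need
   not have an identity. *)
Definition spow (G : magmaType) (x : G) (n : nat) : G :=
  iter n.-1 (fun y => x * y) x.

Lemma spow_morph (G H : magmaType) (f : G -> H) (x : G) n :
  {morph f : x y / x * y} -> f (spow x n) = spow (f x) n.
Proof.
by rewrite /spow => fM; elim: n.-1 => //= k IH; rewrite fM IH.
Qed.

Lemma spowD (G : semigroupType) (x : G) m n : 0 < m -> 0 < n ->
  spow x (m + n) = spow x m * spow x n.
Proof.
case: m => // m _; case: n => // n _; rewrite /spow addSn /=.
by elim: m => [|m IH] /=; rewrite ?add0n // IH mulgA.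
Qed.

Lemma spow_fact_stable (S : finSemigroupType) (s : S) (k N : nat) :
  #|{: S}| <= N -> spow s (N`! + k) = spow s ((#|{: S}|)`! + k).
Proof.
set M := #|{: S}| => leMN.
have M_gt0 : 0 < M.
  by case: (@inhabitedT S) => t; apply/card_gt0P; exists t.
have [i [p [i_gt0 p_gt0 leiM lepM Ep]]] : exists i p, [/\ 0 < i, 0 < p,
    i <= M, p <= M & spow s (i + p) = spow s i].
  pose f (j : 'I_M.+1) := spow s j.+1.
  have /injectivePn[a [b neqab Eab]] : ~~ injectiveb f.
    apply/negP => /injectiveP /leq_card; by rewrite card_ord ltnn.
  wlog ltab : a b neqab Eab / a < b.
    move=> W; case: (ltngtP a b) => [|ltba|/val_inj/eqP]; first exact: W.
      by apply: (W b a) => //; rewrite eq_sym.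
    by rewrite (negPf neqab).
  have leb := ltn_ord b.
  exists a.+1, (b - a); split; rewrite ?subn_gt0 //.
  - by apply: leq_trans ltab _; rewrite -ltnS.
  - by apply: leq_trans (leq_subr _ _) _; rewrite -ltnS.
  by rewrite addSn subnKC ?(ltnW ltab) // -/(f b) -Eab.
have per1 m : i <= m -> spow s (m + p) = spow s m.
  move=> leim; rewrite -(subnK leim).
  case: (posnP (m - i)) => [->|d_gt0]; first by rewrite add0n.
  by rewrite -addnA spowD ?addn_gt0 ?i_gt0 // Ep -spowD.
have per m q : i <= m -> spow s (m + q * p) = spow s m.
  move=> leim; elim: q => [|q IH]; first by rewrite addn0.
  by rewrite mulSnr addnA per1 // (leq_trans leim) ?leq_addr.
have leMfN : M`! <= N`! by apply: leq_fact.
have dvdp n : M <= n -> p %| n`! by move=> leMn; rewrite dvdn_fact ?p_gt0 ?(leq_trans lepM).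
have [q Eq] : exists q, N`! = M`! + q * p.
  have /dvdnP[q Eq] : p %| N`! - M`! by rewrite dvdn_sub ?dvdp.
  by exists q; rewrite -Eq subnKC.
rewrite Eq addnAC per // (leq_trans leiM) // (leq_trans _ (leq_addr _ _)) //.
by case: (M) M_gt0 => // n _; rewrite factS leq_pmulr ?fact_gt0.
Qed.

(* The free profinite semigroup on A is the projective limit of the finite
   semigroups S equipped with a map phi : A -> S.  A point of it is a family
   selecting an element of S for each pair (S, phi), compatibly with the
   morphisms of such pairs.  The component of w at (S, phi) is w_S(phi), the
   image of w under the continuous homomorphism extending phi. *)
Record pseudoword (A : finType) := Pseudoword {
  interp : forall S : finSemigroupType, (A -> S) -> S;
  interp_natural : forall (S T : finSemigroupType) (f : S -> T) (phi : A -> S),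
    {morph f : x y / x * y} -> f (interp phi) = interp (f \o phi)
}.

Arguments interp {A} _ {S} _.

Lemma pseudoword_ext (A : finType) (u v : pseudoword A) :
  (forall (S : finSemigroupType) (phi : A -> S), interp u phi = interp v phi) ->
  u = v.
Proof.
case: u v => [u Hu] [v Hv] /= E.
have Euv : u = v.
  by apply: functional_extensionality_dep => S; apply: funext => phi; exact: E.
by case: v / Euv Hv {E} => Hv; rewrite (Prop_irrelevance Hu Hv).
Qed.

HB.instance Definition _ (A : finType) := gen_eqMixin (pseudoword A).
HB.instance Definition _ (A : finType) := gen_choiceMixin (pseudoword A).

Section PseudowordSemigroup.
Variable A : finType.

Let pmul_natural (u v : pseudoword A) (S T : finSemigroupType) (f : S -> T)
    (phi : A -> S) : {morph f : x y / x * y} ->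
  f (interp u phi * interp v phi) = interp u (f \o phi) * interp v (f \o phi).
Proof. by move=> fM; rewrite fM !(interp_natural _ _ fM). Qed.

Let pmul (u v : pseudoword A) : pseudoword A :=
  Pseudoword (@pmul_natural u v).

Let pmulA : associative pmul.
Proof. by move=> u v w; apply: pseudoword_ext => S phi; exact: mulgA. Qed.

HB.instance Definition _ := isSemigroup.Build (pseudoword A) pmulA.

Lemma interpM (u v : pseudoword A) (S : finSemigroupType) (phi : A -> S) :
  interp (u * v) phi = interp u phi * interp v phi.
Proof. by []. Qed.

End PseudowordSemigroup.

(* The topology of the projective limit: that of a subspace of the product of
   the discrete finite semigroups S. *)
Definition interp_family (A : finType) (w : pseudoword A) :
    prod_topology (fun i : {S : finSemigroupType & A -> S} =>
                     discrete_topology (projT1 i)) :=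
  fun i => interp w (projT2 i).

HB.instance Definition _ (A : finType) :=
  Topological.copy (pseudoword A) (initial_topology (@interp_family A)).

Lemma interp_continuous (A : finType) (S : finSemigroupType) (phi : A -> S) :
  continuous (fun w : pseudoword A => interp w phi : discrete_topology S).
Proof.
move=> w.
exact: (continuous_comp (@initial_continuous _ _ (@interp_family A) w)
  (@proj_continuous {classic {S : finSemigroupType & A -> S}}
    (fun i => discrete_topology (projT1 i)) (existT _ S phi) _)).
Qed.

Lemma nbhs_pseudowordE (A : finType) (w : pseudoword A)
    (U : set (pseudoword A)) :
  nbhs w U <-> exists (S : finSemigroupType) (phi : A -> S),
    [set w' : pseudoword A | interp w' phi = interp w phi] `<=` U.
Proof.
split; last first.
  move=> [S [phi H]]; apply: (filterS H).
  by have := @interp_continuous A S phi w _ (discrete_set1 _).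
pose C (i : {S : finSemigroupType & A -> S}) : set (pseudoword A) :=
  [set w' | interp w' (projT2 i) = interp w (projT2 i)].
pose F : set_system (pseudoword A) := filter_from setT C.
have FF : Filter F.
  apply: filter_from_filter; first by exists (existT (fun S : finSemigroupType => A -> S) unit (fun=> tt)).
  move=> [S phi] [T psi] _ _.
  pose chi (a : A) : (S * T)%type := (phi a, psi a).
  exists (existT (fun S : finSemigroupType => A -> S) (S * T)%type chi) => // w' /= E.
  have E1 (v : pseudoword A) : interp v phi = (interp v chi).1.
    by rewrite (@interp_natural _ v (S * T)%type S fst).
  have E2 (v : pseudoword A) : interp v psi = (interp v chi).2.
    by rewrite (@interp_natural _ v (S * T)%type T snd).
  by split; rewrite /C /= ?E1 ?E2 E.
move=> [_ [[B oB <-] Bw] BU].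
suff [[S phi] _ H] : F U by exists S, phi.
apply: filterS BU _.
have : @interp_family A @ F --> interp_family w.
  apply/cvg_sup => i V [_ [[W oW <-] Ww] WV].
  apply: filterS WV _.
  exists i => // w' /= E; move: Ww; rewrite /= /interp_family.
  by rewrite -E.
by apply; exact: open_nbhs_nbhs.
Qed.

Section Letters.
Variable A : finType.

Let letter_natural (a : A) (S T : finSemigroupType) (f : S -> T)
    (phi : A -> S) : {morph f : x y / x * y} -> f (phi a) = (f \o phi) a.
Proof. by []. Qed.

Definition letter (a : A) : pseudoword A := Pseudoword (@letter_natural a).

(* The word a :: s of A^+ as a pseudoword. *)
Fixpoint word (a : A) (s : seq A) : pseudoword A :=
  if s is b :: s' then letter a * word b s' else letter a.

End Letters.

(* The interpretation of w in the profinite semigroup of pseudowords over B: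
   each letter a of w is replaced by rho a. *)
Section Substitution.
Variables A B : finType.

Let subst_natural (w : pseudoword A) (rho : A -> pseudoword B)
    (S T : finSemigroupType) (f : S -> T) (psi : B -> S) :
  {morph f : x y / x * y} ->
  f (interp w (fun a => interp (rho a) psi)) =
    interp w (fun a => interp (rho a) (f \o psi)).
Proof.
move=> fM; rewrite (interp_natural _ _ fM); congr interp.
by apply: funext => a /=; rewrite (interp_natural _ _ fM).
Qed.

Definition subst (w : pseudoword A) (rho : A -> pseudoword B) : pseudoword B :=
  Pseudoword (@subst_natural w rho).

End Substitution.

Lemma word_interp_natural (A : finType) a (s : seq A) (S : finSemigroupType)
    (h : pseudoword A -> S) : {morph h : x y / x * y} ->
  h (word a s) = interp (word a s) (h \o @letter A).
Proof.
by move=> hM; elim: s a => [//|b s IH] a; rewrite /= hM IH.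
Qed.

(* Swapping the two elements is an automorphism without fixed points, hence
   there is no pseudoword over the empty alphabet. *)
Definition left_zero := bool.
HB.instance Definition _ := Finite.copy left_zero bool.
HB.instance Definition _ := @isSemigroup.Build left_zero
  (fun x _ => x) (fun _ _ _ => erefl).
HB.instance Definition _ := isInhabited.Build left_zero (inhabits true).

Lemma pseudoword_inhabited (A : finType) (w : pseudoword A) : inhabited A.
Proof.
apply: contrapT => A0.
pose phi (a : A) : left_zero := False_rect _ (A0 (inhabits a)).
have /= := @interp_natural A w left_zero left_zero negb phi (fun _ _ => erefl).
have -> : negb \o phi = phi by apply: funext => a; case: (A0 (inhabits a)).
by case: (interp w phi).
Qed.

Definition generated (A : finType) (a0 : A) (S : finSemigroupType)
    (phi : A -> S) : Type :=
  {t : S | `[< exists a s, interp (word a s) phi = t >]}.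

Section Generated.
Variables (A : finType) (a0 : A) (S : finSemigroupType) (phi : A -> S).
Local Notation G := (generated a0 phi).

HB.instance Definition _ := SubType.on G.
HB.instance Definition _ := [Finite of G by <:].

Let gen_closed :
  mulg_closed (fun t => `[< exists a s, interp (word a s) phi = t >]).
Proof.
move=> _ _ /asboolP[a [s <-]] /asboolP[b [t <-]]; apply/asboolP.
exists a, (s ++ b :: t); elim: s a => [//|c s IH] a.
by rewrite /= IH mulgA.
Qed.

HB.instance Definition _ := SubChoice_isSubSemigroup.Build S _ G gen_closed.

Definition generator (a : A) : G :=
  exist _ (phi a) (asboolT (ex_intro _ a (ex_intro _ [::] erefl))).

HB.instance Definition _ := isInhabited.Build G (inhabits (generator a0)).

End Generated.

Lemma word_dense (A : finType) (w : pseudoword A) (S : finSemigroupType)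
  (phi : A -> S) : exists a s, interp (word a s) phi = interp w phi.
Proof.
have [a0] := pseudoword_inhabited w.
have -> : phi = val \o @generator A a0 S phi by apply: funext.
rewrite -(@interp_natural _ w (generated a0 phi) S val) //.
by case: (interp w _) => t /= /asboolP.
Qed.

(* The universal property: interp^~ phi is the unique continuous homomorphism
   extending phi. *)
Lemma interp_unique (A : finType) (S : finSemigroupType)
    (h : pseudoword A -> S) :
  {morph h : x y / x * y} -> continuous (h : _ -> discrete_topology S) ->
  forall w, h w = interp w (h \o @letter A).
Proof.
move=> hM hC w.
have /nbhs_pseudowordE[T [psi H]] := hC w _ (discrete_set1 _).
pose chi (a : A) : (T * S)%type := (psi a, h (letter a)).
have E1 (v : pseudoword A) : interp v psi = (interp v chi).1.
  by rewrite (@interp_natural _ v (T * S)%type T fst).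
have E2 (v : pseudoword A) : interp v (h \o @letter A) = (interp v chi).2.
  by rewrite (@interp_natural _ v (T * S)%type S snd).
have [a [s E]] := word_dense w chi.
have /= <- := H (word a s); last by rewrite /= !E1 E.
by rewrite word_interp_natural // !E2 E.
Qed.

Section OmegaPower.
Variable k : nat.

Let omega_natural (S T : finSemigroupType) (f : S -> T) (phi : unit -> S) :
  {morph f : x y / x * y} ->
  f (spow (phi tt) ((#|{: S}|)`! + k)) =
    spow ((f \o phi) tt) ((#|{: T}|)`! + k).
Proof.
move=> fM; pose N := maxn #|{: S}| #|{: T}|.
rewrite -(@spow_fact_stable S _ k N) ?leq_maxl // (spow_morph _ _ fM).
by rewrite (@spow_fact_stable T _ k N) ?leq_maxr.
Qed.

(* x^(omega+k) for k >= 0, where x is the only letter tt of the alphabet: in a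
   finite semigroup S the sequence s^(n!+k) is constant from n = #|S| on. *)
Definition omega_plus : pseudoword unit := Pseudoword (@omega_natural).

Lemma omega_plus_cvg :
  (fun n => spow (letter tt) (n`! + k)) @ \oo --> omega_plus.
Proof.
move=> U /nbhs_pseudowordE[S [phi H]]; exists #|{: S}| => // n /= leSn.
apply: H; rewrite /= -(@spow_fact_stable S _ k n) //.
by rewrite (@spow_morph _ _ (fun w : pseudoword unit => interp w phi)).
Qed.

End OmegaPower.

(* A possibly empty pseudoword is an option, None being the empty one. *)
Section Factors.
Variable A : finType.
Local Notation pseudoword1 := (option (pseudoword A)).
Implicit Types (u w : pseudoword1) (v s : seq A).

Definition mul1 (u w : pseudoword1) : pseudoword1 :=
  match u, w with
  | Some u, Some w => Some (u * w)
  | None, _ => w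
  | _, None => u
  end.

Definition word1 (s : seq A) : pseudoword1 :=
  if s is a :: s' then Some (word a s') else None.

Local Notation "u ** w" := (mul1 u w) (at level 40, left associativity).

Definition is_suffix v w := exists w', w = w' ** word1 v.

Definition is_factor v w := exists w' w'', w = w' ** word1 v ** w''.

Definition two_disjoint_occurrences v w :=
  exists w0 w1 w2, w = w0 ** word1 v ** w1 ** word1 v ** w2.

Definition factor_near_end v w :=
  exists s, is_suffix s w /\ is_factor v (word1 s).

End Factors.

Definition satisfies (S : finSemigroupType) (A : finType)
    (u v : pseudoword A) : Prop :=
  forall phi : A -> S, interp u phi = interp v phi.

(* The new variable z is the letter None of option A. *)
Definition satisfies_eq1 (S : finSemigroupType) (A : finType)
    (w : pseudoword A) : Prop :=
  let w' := subst w (fun a => letter (Some a)) in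
  let z := letter None in
  satisfies S (w' * z) z /\ satisfies S z (z * w').

Definition models (V : set finSemigroupType) (A : finType)
    (u v : pseudoword A) : Prop :=
  forall S, V S -> satisfies S u v.

(* The closure under the empty product is the first clause. *)
Record pseudovariety (V : set finSemigroupType) : Prop := Pseudovariety {
  pseudovariety_unit : V unit;
  pseudovariety_prod : forall S T : finSemigroupType, V S -> V T ->
    V (S * T)%type;
  pseudovariety_sub : forall (S T : finSemigroupType) (f : S -> T),
    {morph f : x y / x * y} -> injective f -> V T -> V S;
  pseudovariety_quot : forall (S T : finSemigroupType) (f : S -> T),
    {morph f : x y / x * y} -> (forall t, exists s, f s = t) -> V S -> V T
}.

Definition infinite_exponent (V : set finSemigroupType) : Prop :=
  forall n, 0 < n -> ~ models V (omega_plus n) (omega_plus 0).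

Definition is_group (G : finSemigroupType) : Prop :=
  exists e : G, (forall x : G, e * x = x /\ x * e = x) /\
    (forall x : G, exists y : G, y * x = e /\ x * y = e).

Definition Ab : set finSemigroupType :=
  [set G | is_group G /\ forall x y : G, x * y = y * x].

(* For nonempty sigma, every member is a group: if S satisfies w = 1, each
   element of S has a positive power equal to the identity. *)
Definition H_ (A : finType) (sigma : set (pseudoword A)) :
    set finSemigroupType :=
  [set S | forall w, sigma w -> satisfies_eq1 S w].

Definition CR (H : set finSemigroupType) : set finSemigroupType :=
  [set S | satisfies S (omega_plus 1) (letter tt) /\
    forall (G : finSemigroupType) (f : G -> S), is_group G ->
      {morph f : x y / x * y} -> injective f -> H G].

Record implicit_signature := ImplicitSignature {
  operations :> forall B : finType, set (pseudoword B);
  operations_mul : operations (letter true * letter false)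
}.

Inductive tau_word (tau : implicit_signature) (A : finType) :
    pseudoword A -> Prop :=
| tau_word_letter (a : A) : tau_word tau (letter a)
| tau_word_operation (B : finType) (w : pseudoword B)
    (rho : B -> pseudoword A) :
    tau B w -> (forall b, tau_word tau (rho b)) -> tau_word tau (subst w rho).

Definition solution (V : set finSemigroupType) (A : finType)
    (S : finSemigroupType) (phi : pseudoword A -> S) (s t : S)
    (u v : pseudoword A) : Prop :=
  [/\ models V u v, phi u = s & phi v = t].

Definition reducible (V : set finSemigroupType) (tau : implicit_signature) :
    Prop :=
  forall (A : finType) (S : finSemigroupType) (phi : pseudoword A -> S),
    {morph phi : x y / x * y} ->
    continuous (phi : pseudoword A -> discrete_topology S) ->
    (forall s, exists w, phi w = s) ->
  forall s t : S,
    (exists u v, solution V phi s t u v) ->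
    exists u v,
      [/\ tau_word tau u, tau_word tau v & solution V phi s t u v].

(* The letters x and y of the binary operations are true and false. *)
Inductive sigma_omega_ops (sigma : set (pseudoword bool)) :
    forall B : finType, set (pseudoword B) :=
| sigma_omega_mul : sigma_omega_ops sigma (letter true * letter false)
| sigma_omega_sigma (w : pseudoword bool) :
    sigma w -> sigma_omega_ops sigma w
| sigma_omega_omega : sigma_omega_ops sigma (omega_plus 0).

Definition sigma_omega (sigma : set (pseudoword bool)) : implicit_signature :=
  ImplicitSignature (sigma_omega_mul sigma).

(* Main.v *)
From HB Require Import structures.
From mathcomp Require Import all_boot monoid.
From mathcomp Require Import boolp classical_sets.
Require Import Defs.
Set Implicit Arguments.
Unset Strict Implicit.
Unset Printing Implicit Defensive.
Local Open Scope classical_set_scope.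
Local Open Scope group_scope.

(** Write [x] and [y] for the two letters.  The triple that admits a solution
    but no solution in tau-words comes from the pseudoidentity [u = xy], where
    [u = x^(omega-1) (x^(omega+2) y^(omega+1))^(omega-1) x^(omega+2) yxxy].
    It holds in every completely regular semigroup: there [x^(omega+2) = x^2]
    and [y^(omega+1) = y], so that, for [m = xxy], the pseudoword [u] becomes
    [x^(omega-1) m^(omega-1) m m = x^(omega-1) m = xy]
    ([CR_long_solution]).

    The finite semigroup of the triple is the transition semigroup of an
    automaton that reads a word consisting of blocks of at least three [x] and
    of at least two [y], and then ends, after a last block of [x], with [yxxy].
    In such a word the factors of length 4 which end at one of its last three
    positions, namely [xxyx], [xyxx] and [yxxy], occur only once, and no cube
    ends there.  Hence neither a value of the [omega]-power nor a value of an
    operation of [sigma] may end at one of these three positions: it either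
    ends with a cube, or repeats its suffix of length at least 4
    ([cube_suffix_avoids_final], [repeated_suffix_avoids_final],
    [omega_avoids_final]).  An operation of [sigma] does have a suffix of
    length 4, for otherwise it would be a word of length [n <= 3] and the
    groups of [H_ sigma] would satisfy [x^n = 1], against the infinite exponent.

    A tau-word is a product of letters and of values of operations.  In a
    group of [H_ sigma], evaluated at a single element [g], the values of the
    operations vanish and a tau-word becomes [g^n] with [n >= 0]
    ([tau_word_shape]).  A tau-word with the same transformation as [u] has at
    least three letters after the last value of an operation, if any, whence
    [n >= 3]; a tau-word with the same transformation as [xy] is the word [xy]
    itself, whence [n = 2].  If these two were equal over [V], then some
    [g^(n-2)] with [n > 2] would be trivial in all abelian members of
    [H_ sigma], against the infinite exponent of [H_ sigma], which is already
    witnessed by cyclic groups ([infinite_exponent_cyclic]). *)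

Local Infix "**" := mul1 (at level 40, left associativity).

(** * Powers in finite semigroups and the operation [x^(omega-1)] *)

Lemma spowSr (S : semigroupType) (s : S) n : 0 < n ->
  spow s n.+1 = spow s n * s.
Proof. by move=> n_gt0; rewrite -addn1 spowD. Qed.

Section OmegaMinusOne.

Let exponent (S : finSemigroupType) := (#|{: S}|)`! + ((#|{: S}|)`!).-1.

(* Only a leading factorial can be changed; since [N! + (M! - 1)] equals
   [M! + (N! - 1)], each of the two becomes the leading one in turn. *)
Let exponent_stable (S : finSemigroupType) (s : S) N : #|{: S}| <= N ->
  spow s (N`! + (N`!).-1) = spow s (exponent S).
Proof.
move=> leSN; rewrite spow_fact_stable //.
have swap m n : 0 < m -> 0 < n -> m + n.-1 = n + m.-1.
  by case: m => // m; case: n => // n _ _; rewrite addSn addnC addSn.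
by rewrite swap ?fact_gt0 // spow_fact_stable.
Qed.

Let omega_minus1_natural (S T : finSemigroupType) (f : S -> T)
    (phi : unit -> S) : {morph f : x y / x * y} ->
  f (spow (phi tt) (exponent S)) = spow ((f \o phi) tt) (exponent T).
Proof.
move=> fM; pose N := maxn #|{: S}| #|{: T}|.
rewrite -(@exponent_stable S _ N) ?leq_maxl // (spow_morph _ _ fM).
by rewrite (@exponent_stable T _ N) ?leq_maxr.
Qed.

(** In a semigroup [S] with [N] elements, [x^(omega-1)] is taken to be
    [x^(N! + (N! - 1))]: the first summand reaches the periodic part of the
    powers of [x] whatever the second one is. *)
Definition omega_minus1 : pseudoword unit := Pseudoword (@omega_minus1_natural).

End OmegaMinusOne.

Definition omega_power (A : finType) k (u : pseudoword A) : pseudoword A :=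
  subst (omega_plus k) (fun=> u).

Definition omega_inv (A : finType) (u : pseudoword A) : pseudoword A :=
  subst omega_minus1 (fun=> u).

(** * Splitting off the last letter of a pseudoword *)

(** The value of a word [s a] together with its last letter [a]: [inl a] stands
    for the letter [a] alone and [inr (t, a)] for a word [s a] where [s] has
    value [t].  Interpreting a pseudoword in this semigroup, for all [S] at
    once, yields the pseudoword that remains once the last letter is deleted. *)
Definition split_last (S : finSemigroupType) (phi : bool -> S) : Type :=
  (bool + S * bool)%type.

Section SplitLast.
Variables (S : finSemigroupType) (phi : bool -> S).
Local Notation T := (split_last phi).

Definition unsplit (t : T) : S :=
  match t with inl i => phi i | inr (s, i) => s * phi i end.

Definition split_mul (t t' : T) : T :=
  match t' with
  | inl a => inr (unsplit t, a)
  | inr (s, a) => inr (unsplit t * s, a)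
  end.

Let split_mulA : associative split_mul.
Proof. by move=> [a|[s a]] [b|[s' b]] [c|[s'' c]]; rewrite /= ?mulgA. Qed.

HB.instance Definition _ := Finite.copy T (bool + S * bool)%type.
HB.instance Definition _ := @isSemigroup.Build T split_mul split_mulA.
HB.instance Definition _ := isInhabited.Build T (inhabits (inl true)).

Lemma unsplitM : {morph unsplit : t t' / t * t'}.
Proof. by move=> t [b|[s b]] //=; rewrite mulgA. Qed.

Definition split_letter (a : bool) : T := inl a.

End SplitLast.

Section SplitLastMap.
Variables (S T : finSemigroupType) (f : S -> T).
Variable phi : bool -> S.

Definition split_map (t : split_last phi) : split_last (f \o phi) :=
  match t with inl a => inl a | inr (s, a) => inr (f s, a) end.

Lemma split_mapM : {morph f : x y / x * y} ->
  {morph split_map : t t' / t * t'}.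
Proof.
by move=> fM [a|[s a]] [b|[s' b]] //=; rewrite /mul /= /split_mul /= ?fM.
Qed.

End SplitLastMap.

Lemma interp_unsplit (w : pseudoword bool)
    (S : finSemigroupType) (phi : bool -> S) :
  interp w phi = unsplit (interp w (split_letter phi)).
Proof. by rewrite (interp_natural _ _ (@unsplitM S phi)). Qed.

(** Comparison with the one-element semigroup shows that neither the last letter
    nor the fact that something precedes it depends on the semigroup in which
    the pseudoword is interpreted. *)
Lemma pseudoword_split_last (w : pseudoword bool) :
  exists a, w = letter a \/ exists w', w = w' * letter a.
Proof.
pose L (S : finSemigroupType) (phi : bool -> S) := interp w (split_letter phi).
have L_natural (S T : finSemigroupType) (f : S -> T) (phi : bool -> S) :
    {morph f : x y / x * y} -> split_map f (L S phi) = L T (f \o phi).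
  by move=> fM; exact: interp_natural (split_mapM fM).
have LE (S : finSemigroupType) (phi : bool -> S) :
    L unit (fun=> tt) = split_map (fun=> tt) (L S phi).
  by rewrite L_natural.
case E: (L unit (fun=> tt)) => [a|[[] a]]; exists a; [left|right].
  apply: pseudoword_ext => S phi; rewrite interp_unsplit -/(L S phi) /=.
  by move: E; rewrite (LE S phi) /=; case: (L S phi) => [b [->]|[]].
pose p (S : finSemigroupType) (phi : bool -> S) :=
  match L S phi with inl i => phi i | inr (s, _) => s end.
have p_natural (S T : finSemigroupType) (f : S -> T) (phi : bool -> S) :
    {morph f : x y / x * y} -> f (p S phi) = p T (f \o phi).
  by move=> fM; rewrite /p -L_natural //; case: (L S phi) => [b|[s b]].
exists (Pseudoword p_natural); apply: pseudoword_ext => S phi.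
rewrite interp_unsplit -/(L S phi) interpM /= /p.
by move: E; rewrite (LE S phi) /=; case: (L S phi) => [|[s b] [->]].
Qed.

Lemma mul1A (A : finType) : associative (@mul1 A).
Proof. by move=> [u|] [v|] [w|] //=; rewrite mulgA. Qed.

Lemma mul1None (A : finType) (u : option (pseudoword A)) : u ** None = u.
Proof. by case: u. Qed.

Lemma word1_cat (A : finType) (s t : seq A) :
  word1 (s ++ t) = word1 s ** word1 t.
Proof.
case: s => [//|a s]; elim: s a => [|b s IH] a; first by case: t.
move: (IH b) => /=; case: t {IH} => [|c t] /=; first by rewrite cats0.
by move=> [->]; rewrite mulgA.
Qed.

Lemma pseudoword_suffix (n : nat) (w : pseudoword bool) :
  (exists a s, size s < n /\ w = word a s) \/
  (exists s, size s = n /\ is_suffix s (Some w)).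
Proof.
elim: n => [|n [[a [s [lesn ->]]]|[s [<- [[w'|] Ew]]]]].
- by right; exists [::]; split; last by exists (Some w).
- by left; exists a, s; split=> //; exact: ltnW.
- right; have [a [Ew'|[w'' Ew']]] := pseudoword_split_last w'.
    exists (a :: s); split=> //; exists None.
    by rewrite Ew Ew' -[Some _]/(word1 [:: a]) -word1_cat.
  exists (a :: s); split=> //; exists (Some w'').
  rewrite Ew Ew' -[Some (_ * _)]/(Some w'' ** word1 [:: a]) -mul1A.
  by rewrite -word1_cat.
- by left; case: s Ew => [//|a s] /= [->]; exists a, s.
Qed.

(** * The automaton *)

(** A copy of a finite type in [Set].  A [finSemigroupType] lives in a universe
    below that of [finType], too low for types of finite functions; such a copy
    of them can be given a semigroup structure. *)
Definition small (T : finType) : Set := {n : nat | n < #|T|}.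

Section Small.
Variable T : finType.

Definition shrink (t : T) : small T := exist _ (val (enum_rank t)) (ltn_ord _).
Definition unshrink (s : small T) : T := enum_val (Ordinal (svalP s)).

Lemma shrinkK : cancel shrink unshrink.
Proof.
move=> t; rewrite /unshrink -[RHS]enum_rankK; congr enum_val.
exact: val_inj.
Qed.

Lemma unshrinkK : cancel unshrink shrink.
Proof.
move=> [n ltn]; rewrite /shrink /unshrink.
by apply: eq_exist; rewrite enum_valK.
Qed.

HB.instance Definition _ := Finite.copy (small T) (can_type unshrinkK).

End Small.

(** [X1], [X2], [X3] are reached after one, two, and at least three letters of
    a block of [x]; [Y1] and [Y2] after one, and at least two letters of a block
    of [y].  A single [y] after a long block of [x] must be the beginning of
    [yxxy], the rest of which leads from [Y1] through [E1] and [E2] to [E3]. *)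
Inductive state := X1 | X2 | X3 | Y1 | Y2 | E1 | E2 | E3 | Dead.

Section State.

Let states := [:: X1; X2; X3; Y1; Y2; E1; E2; E3; Dead].

Let rank (q : state) : nat :=
  match q with
  | X1 => 0 | X2 => 1 | X3 => 2 | Y1 => 3 | Y2 => 4
  | E1 => 5 | E2 => 6 | E3 => 7 | Dead => 8
  end.

Let rankK : cancel rank (nth Dead states).
Proof. by case. Qed.

HB.instance Definition _ := Countable.copy state (can_type rankK).

Let states_enum : Finite.axiom states.
Proof. by case. Qed.

HB.instance Definition _ := isFinite.Build state states_enum.

End State.

Definition step (q : state) (a : bool) : state :=
  match q, a with
  | X1, true => X2 | X2, true => X3 | X3, true => X3
  | X3, false => Y1 | Y1, false => Y2 | Y2, false => Y2
  | Y2, true => X1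
  | Y1, true => E1 | E1, true => E2 | E2, false => E3
  | _, _ => Dead
  end.

Definition run : state -> seq bool -> state := foldl step.

Definition final (q : state) : bool :=
  if q is (E1 | E2 | E3) then true else false.

Definition late (q : state) : bool :=
  if q is (E1 | E2 | E3 | Dead) then true else false.

Lemma late_run q s : late q -> late (run q s).
Proof. by elim: s q => [|a s IH] q //= lq; apply: IH; case: q a lq => -[]. Qed.

(** From [E1] at most two more letters can be read. *)
Lemma late_dead q s : late q -> 2 < size s -> run q s = Dead.
Proof.
have Dead_run t : run Dead t = Dead by elim: t.
by move=> lq; case: s => [|a [|b [|c s]]] //= _;
  case: q lq => // _; case: a => //=; case: b => //=; case: c => //=.
Qed.

(** The last four letters of a long word that leads to [E1], [E2] or [E3] are
    [xxyx], [xyxx] or [yxxy] respectively, and from no state do these letters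
    lead back to a block. *)
Lemma final_reset s q q' : 3 < size s -> final (run q s) -> late (run q' s).
Proof.
move=> les.
(* Only the last four letters matter. *)
have -> : s = take (size s - 4) s ++ drop (size s - 4) s.
  by rewrite cat_take_drop.
have : size (drop (size s - 4) s) = 4 by rewrite size_drop subKn.
rewrite /run !foldl_cat; move: (foldl _ q _) (foldl _ q' _) => {}q {}q'.
case: (drop _ _) => [|a [|b [|c [|d []]]]] //= _ {s les}.
by case: q q' a b c d => -[] [] [] [] [].
Qed.

(** A cube of a word of length at least 4 repeats its last four letters; the
    shorter words are finitely many. *)
Lemma cube_not_final s q : s != [::] -> ~~ final (run q (s ++ s ++ s)).
Proof.
move=> s_neq0; rewrite /run !foldl_cat; apply/negP.
have [les|] := leqP 4 (size s); last first.
  case: s s_neq0 => [|a [|b [|c [|d s]]]] //= _ _.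
  - by case: q a => -[].
  - by case: q a b => -[] [].
  - by case: q a b c => -[] [] [].
move=> fin; have := fin; rewrite -/(run _ s) late_dead //; last exact: ltnW.
exact: final_reset fin.
Qed.

(** * Pseudowords acting on the states *)

Definition transformation : Set := small {ffun state -> state}.

Definition act (f : transformation) (q : state) : state := unshrink f q.

Section Transformations.

Let comp (f g : transformation) : transformation :=
  shrink [ffun q => act g (act f q)].

Let compA : associative comp.
Proof.
move=> f g h; congr shrink; apply/ffunP => q.
by rewrite !ffunE /act !shrinkK !ffunE.
Qed.

HB.instance Definition _ := Finite.copy transformation
  (small {ffun state -> state}).
HB.instance Definition _ := @isSemigroup.Build transformation comp compA.
HB.instance Definition _ :=
  isInhabited.Build transformation (inhabits (shrink [ffun q => q])).

Lemma actM (f g : transformation) q : act (f * g) q = act g (act f q).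
Proof. by rewrite /act shrinkK ffunE. Qed.

End Transformations.

Definition transition (a : bool) : transformation :=
  shrink [ffun q => step q a].

Lemma act_transition a q : act (transition a) q = step q a.
Proof. by rewrite /act shrinkK ffunE. Qed.

Lemma act_word a s q : act (interp (word a s) transition) q = run q (a :: s).
Proof.
elim: s a q => [|b s IH] a q; first exact: act_transition.
by rewrite [word a _]/= interpM actM IH act_transition.
Qed.

Lemma act_spow (f : transformation) n q :
  act (spow f n.+1) q = iter n.+1 (act f) q.
Proof.
by elim: n => [//|n IH]; rewrite spowSr // actM IH.
Qed.

(** By density every pseudoword over [{x, y}] acts as a nonempty word; this is
    all that matters about the arguments of an operation. *)
Definition wordlike (f : transformation) : Prop :=
  exists s, s != [::] /\ act f =1 run^~ s.

Definition act1 (B : finType) (psi : B -> transformation)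
    (w : option (pseudoword B)) (q : state) : state :=
  if w is Some w then act (interp w psi) q else q.

Lemma act1M (B : finType) (psi : B -> transformation) u w q :
  act1 psi (u ** w) q = act1 psi w (act1 psi u q).
Proof. by case: u w => [u|] [w|] //=; rewrite actM. Qed.

Section Wordlike.
Variables (B : finType) (psi : B -> transformation).
Hypothesis psi_wordlike : forall b, wordlike (psi b).

Lemma acts_as_word1 (v : seq B) :
  exists s, size v <= size s /\ act1 psi (word1 v) =1 run^~ s.
Proof.
elim: v => [|b v [t [levt Et]]]; first by exists [::].
have [s [s_neq0 Es]] := psi_wordlike b.
exists (s ++ t); split.
  by rewrite size_cat -[size (b :: v)]add1n leq_add // lt0n size_eq0.
move=> q; rewrite /run foldl_cat -/(run _ s) -Es -/(run _ t) -Et.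
by rewrite -[b :: v]/([:: b] ++ v) word1_cat act1M.
Qed.

Lemma wordlike_interp (w : pseudoword B) : wordlike (interp w psi).
Proof.
have [b [v <-]] := word_dense w psi.
have [s [les Es]] := acts_as_word1 (b :: v).
by exists s; split=> //; case: s les {Es}.
Qed.

Lemma late_act1 (w : option (pseudoword B)) q : late q -> late (act1 psi w q).
Proof.
case: w => [w|//] lq; have [s [_ Es]] := wordlike_interp w.
by rewrite /= Es late_run.
Qed.

End Wordlike.

Lemma transition_wordlike a : wordlike (transition a).
Proof. by exists [:: a]; split=> // q; rewrite act_transition. Qed.

Definition avoids_final (f : transformation) : Prop :=
  forall q, ~~ final (act f q).

Section AvoidsFinal.
Variables (B : finType) (psi : B -> transformation) (w : pseudoword B).
Hypothesis psi_wordlike : forall b, wordlike (psi b).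

Lemma cube_suffix_avoids_final b :
  is_suffix [:: b; b; b] (Some w) -> avoids_final (interp w psi).
Proof.
move=> [w' Ew] q; have [s [s_neq0 Es]] := psi_wordlike b.
have -> : act (interp w psi) q = run (act1 psi w' q) (s ++ s ++ s).
  rewrite -[LHS]/(act1 psi (Some w) q) Ew act1M /=.
  by rewrite !actM !Es /run !foldl_cat.
exact: cube_not_final.
Qed.

(** If the suffix [v] led to one of the last three states, then already its first
    occurrence would lead to the final part of the automaton or to [Dead], and
    the final part is too short for another occurrence. *)
Lemma repeated_suffix_avoids_final v : 3 < size v ->
  is_suffix v (Some w) -> two_disjoint_occurrences v (Some w) ->
  avoids_final (interp w psi).
Proof.
move=> lev [w' Ew] [w0 [w1 [w2 Ew2]]] q; apply/negP => fin.
have [s [levs Es]] := acts_as_word1 psi_wordlike v.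
have les := leq_trans lev levs.
have reset q' : late (run q' s).
  apply: (final_reset (q := act1 psi w' q)) => //.
  by move: fin; rewrite -[act _ q]/(act1 psi (Some w) q) Ew act1M Es.
move: fin; rewrite -[act _ q]/(act1 psi (Some w) q) Ew2 !act1M !Es.
rewrite (late_dead (q := act1 psi w1 _)) ?late_act1 ?(ltnW les) //.
case: w2 {Ew2} => [w2|//]; rewrite /=.
by have [t [_ ->]] := wordlike_interp psi_wordlike w2; elim: t.
Qed.

End AvoidsFinal.

Lemma omega_avoids_final (psi : unit -> transformation) :
  wordlike (psi tt) -> avoids_final (interp (omega_plus 0) psi).
Proof.
move=> [s [s_neq0 Es]] q; rewrite /=.
(* With exponent [(M + 3)!], which is at least 3, the power ends with a cube. *)
set M := #|_|; rewrite -(@spow_fact_stable _ _ 0 (M + 3)) ?leq_addr // addn0.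
have : 3 <= (M + 3)`!.
  apply: leq_trans (leq_addl M 3) _.
  by case: (M + 3) => // n; rewrite factS leq_pmulr ?fact_gt0.
case: _`! => [|[|[|n]]] // _; rewrite act_spow 3!iterS !Es.
have := @cube_not_final s (iter n (act (psi tt)) q) s_neq0.
by rewrite /run !foldl_cat.
Qed.

(** * Exponents of tau-words in the groups of [H_ sigma] *)

Definition is_identity (G : magmaType) (e : G) : Prop :=
  forall x, e * x = x /\ x * e = x.

Definition pow (G : magmaType) (e g : G) (n : nat) : G := iter n (mul g) e.

Lemma powD (G : semigroupType) (e g : G) m n : is_identity e ->
  pow e g (m + n) = pow e g m * pow e g n.
Proof.
move=> eP; rewrite /pow iterD; elim: m => [|m IH] /=; first by rewrite (eP _).1.
by rewrite IH mulgA.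
Qed.

Lemma spow_pow (G : semigroupType) (e g : G) n : is_identity e ->
  spow g n.+1 = pow e g n.+1.
Proof.
move=> eP; elim: n => [|n IH]; first by rewrite /= (eP g).2.
by rewrite -[LHS]/(g * spow g n.+1) IH.
Qed.

Lemma interp_word_const (A : finType) a (s : seq A) (S : finSemigroupType)
    (g : S) : interp (word a s) (fun=> g) = spow g (size s).+1.
Proof. by elim: s a => [//|b s IH] a; rewrite /= IH. Qed.

Section GroupsH.
Variable sigma : set (pseudoword bool).

Lemma H_sub (S T : finSemigroupType) (f : S -> T) :
  {morph f : x y / x * y} -> injective f -> H_ sigma T -> H_ sigma S.
Proof.
by move=> fM f_inj HT w /HT[Hl Hr]; split=> phi; apply: f_inj;
  rewrite !(interp_natural _ _ fM).
Qed.

Lemma H_interp (S : finSemigroupType) w (psi : bool -> S) :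
  H_ sigma S -> sigma w -> is_identity (interp w psi).
Proof.
move=> HS /HS[Hl Hr] z.
pose phi (o : option bool) := if o is Some a then psi a else z.
by split; [exact: (Hl phi) | exact/esym/(Hr phi)].
Qed.

Lemma identity_unique (G : magmaType) (e e' : G) :
  is_identity e -> is_identity e' -> e = e'.
Proof. by move=> eP e'P; rewrite -[LHS](e'P e).2 (eP e').1. Qed.

Hypothesis sigma_neq0 : sigma !=set0.

(** A member of [sigma] takes the same value at [g] as some word, so [e] is a
    power of [g] with positive exponent [k], and [k] divides large
    factorials. *)
Lemma H_omega (S : finSemigroupType) (e g : S) : H_ sigma S -> is_identity e ->
  spow g (#|{: S}|)`! = e.
Proof.
move=> HS eP; have [w sw] := sigma_neq0.
have : interp w (fun=> g) = e by apply: identity_unique (H_interp _ HS sw) eP.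
have [a [s <-]] := word_dense w (fun=> g).
rewrite interp_word_const (spow_pow _ _ eP); set k := (size s).+1 => gk.
have /dvdnP[j Ej] : k %| (#|{: S}| + k)`! by rewrite dvdn_fact ?leq_addl.
rewrite -[(#|{: S}|)`!]addn0 -(@spow_fact_stable _ g 0 (#|{: S}| + k));
  last exact: leq_addr.
rewrite addn0; have := fact_gt0 (#|{: S}| + k); case E : _`! => [//|n] _.
rewrite (spow_pow _ _ eP) -E Ej; elim: j {Ej E} => [//|j IH].
by rewrite mulSn powD // gk IH (eP e).1.
Qed.

Lemma H_group (S : finSemigroupType) : H_ sigma S -> is_group S.
Proof.
move=> HS; have [w sw] := sigma_neq0; have [z] := @inhabitedT S.
pose e := interp w (fun=> z); have eP : is_identity e by exact: H_interp.
exists e; split=> [//|x]; have := H_omega x HS eP.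
have := fact_gt0 #|{: S}|; case: _`! => [//|n] _.
rewrite (spow_pow _ _ eP) => xn; exists (pow e x n); split; last exact: xn.
rewrite -{2}[x](eP x).2 -[x * e]/(pow e x 1) -powD //.
by rewrite addn1.
Qed.

(** The infinite exponent of [H_ sigma] is witnessed by the cyclic subgroup
    generated by an element [g] of a group that violates
    [x^(omega+n) = x^omega]. *)
Lemma infinite_exponent_cyclic : infinite_exponent (H_ sigma) ->
  forall n, 0 < n -> exists (G : finSemigroupType) (e g : G),
    [/\ H_ sigma G, Ab G, is_identity e & pow e g n <> e].
Proof.
move=> infexp n n_gt0; apply: contrapT => no_group.
apply: (infexp n n_gt0) => S HS phi.
pose C := generated tt phi : finSemigroupType.
have valM : {morph (val : C -> S) : x y / x * y} by [].
have HC : H_ sigma C := H_sub valM val_inj HS.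
have CE (c : C) : exists k, val c = spow (phi tt) k.+1.
  case: c => c /= /asboolP[[] [s <-]]; exists (size s).
  rewrite -(interp_word_const tt); congr interp.
  by apply: funext => -[].
have AbC : Ab C.
  split; first exact: H_group.
  move=> c d; apply: val_inj; rewrite !valM.
  by have [k ->] := CE c; have [l ->] := CE d; rewrite -!spowD // addnC.
have [e [eP _]] := AbC.1.
have -> : phi = val \o @generator unit tt S phi by apply: funext => -[].
rewrite -!(interp_natural _ _ valM); congr val => /=.
rewrite addn0 spowD ?fact_gt0 //; set g := generator _ _ _.
suff -> : spow g n = e by rewrite (eP _).2.
case: n n_gt0 no_group => // n _ no_group; rewrite (spow_pow _ _ eP).
by apply: contrapT => gn; apply: no_group; exists C, e, g.
Qed.

(** Sending all letters to the same [g] leaves only the total exponent of [u];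
    this is enough, and cyclic groups can detect it. *)
Definition erases_to (u : pseudoword bool) (n : nat) : Prop :=
  forall G : finSemigroupType, H_ sigma G ->
    forall e g : G, is_identity e -> interp u (fun=> g) = pow e g n.

(** The factor [w] stands for the last value of an operation in a product, and
    [r] for the letters after it, which all contribute to the exponent [n]. *)
Definition avoiding_factor (u : pseudoword bool) (n : nat) : Prop :=
  exists p w r, [/\ Some u = p ** Some w ** word1 r,
    avoids_final (interp w transition) & size r <= n].

Hypothesis sigma_avoids_final : forall w, sigma w ->
  forall psi, (forall b, wordlike (psi b)) -> avoids_final (interp w psi).

(** A value of the [omega]-power or of an operation of [sigma] is trivial in the
    groups of [H_ sigma], so exponents add up along products and are never
    negative. *)
Lemma tau_word_shape u : tau_word (sigma_omega sigma) u ->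
  exists n, erases_to u n /\
    ((exists a s, u = word a s /\ n = (size s).+1) \/ avoiding_factor u n).
Proof.
elim=> [a|B w rho sw _ IH].
  exists 1%N; split; last by left; exists a, [::].
  by move=> G _ e g eP; rewrite /= (eP g).2.
have rho_wordlike b : wordlike (interp (rho b) transition).
  exact: wordlike_interp transition_wordlike _.
case: B w / sw rho IH rho_wordlike => [|w sw|] rho IH rho_wordlike.
- have -> : subst (letter true * letter false) rho = rho true * rho false.
    exact: pseudoword_ext.
  move: (IH true) (IH false); move: (rho true) (rho false).
  move=> {}u v [m [Eu Su]] [n [Ev Sv]]; exists (m + n); split.
    by move=> G HG e g eP; rewrite interpM (Eu G HG e) // (Ev G HG e) // powD.
  case: Sv => [[b [t [-> ->]]]|[p [w [r [Evw avw ler]]]]]; last first.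
    right; exists (Some u ** p), w, r; split=> //;
      last exact: leq_trans (leq_addl _ _).
    by rewrite -[LHS]/(Some u ** Some v) Evw !mul1A.
  case: Su => [[a [s [-> ->]]]|[p [w [r [Euw avw ler]]]]].
    left; exists a, (s ++ b :: t); split; last by rewrite size_cat addSn.
    by have [] := word1_cat (a :: s) (b :: t).
  right; exists p, w, (r ++ b :: t); split=> //;
    last by rewrite size_cat leq_add.
  by rewrite -[LHS]/(Some u ** word1 (b :: t)) Euw word1_cat mul1A.
- exists 0; split; last first.
    right; exists None, (subst w rho), [::]; split=> //.
    exact: (sigma_avoids_final sw (psi := fun b => interp (rho b) transition)).
  move=> G HG e g eP; exact: identity_unique (H_interp _ HG sw) eP.
- exists 0; split; last first.
    right; exists None, (subst (omega_plus 0) rho), [::]; split=> //.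
    exact: (omega_avoids_final (psi := fun b => interp (rho b) transition)).
  by move=> G HG e g eP; rewrite /= addn0 (H_omega _ HG eP).
Qed.

End GroupsH.

(** * The solution *)

Local Notation x := (letter true : pseudoword bool).
Local Notation y := (letter false : pseudoword bool).

(** Before the final [yxxy] the letters occur only in infinite powers, which are
    long blocks; in a completely regular semigroup, [x^(omega+2)] and
    [y^(omega+1)] still have the values [x^2] and [y]. *)
Definition long_solution : pseudoword bool :=
  omega_inv x * omega_inv (omega_power 2 x * omega_power 1 y)
    * omega_power 2 x * (y * (x * (x * y))).

Lemma CR_long_solution (S : finSemigroupType) :
  satisfies S (omega_plus 1) (letter tt) -> satisfies S long_solution (x * y).
Proof.
move=> CRS phi; rewrite /long_solution !interpM /=.
move: (phi true) (phi false) => a b.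
set n := _`!; have n_gt0 : 0 < n := fact_gt0 _.
have CRn (s : S) : spow s (n + 1) = s := CRS (fun=> s).
have CR2 (s : S) : spow s (n + 2) = s * s.
  by rewrite addn2 spowSr // -[n.+1]addn1 CRn.
have inv2 (s : S) : spow s (n + n.-1) * (s * s) = s.
  have pos : 0 < n + n.-1 by rewrite addn_gt0 n_gt0.
  rewrite -[s * s]/(spow s 2) -spowD // -addnA.
  have -> : n.-1 + 2 = n + 1 by rewrite addn2 addn1 prednK.
  by rewrite spowD ?addn1 // -addn1 CRn -[X in _ * X]/(spow s 1) -spowD // CRn.
rewrite CR2 CRn.
move: (inv2 a) (inv2 (a * a * b)).
move: (spow a _) (spow (a * a * b) _) => c d inv_a inv_aab.
transitivity (c * (d * ((a * a * b) * (a * a * b)))); first by rewrite !mulgA.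
by rewrite inv_aab mulgA inv_a.
Qed.

(** The run starts in [X3], as if a long block of [x] had already been read, so
    that no lower bound on the exponent standing for [omega-1] is needed. *)
Lemma act_long_solution : act (interp long_solution transition) X3 = E3.
Proof.
rewrite /long_solution !interpM !actM !act_transition /=.
have iter_X3 n : iter n (act (transition true)) X3 = X3.
  by elim: n => //= n ->; rewrite act_transition.
have iter_Y2 n : iter n (act (transition false)) Y2 = Y2.
  by elim: n => //= n ->; rewrite act_transition.
set n := _`!; have := fact_gt0 #|{: transformation}|.
rewrite -/n; case: n => // n _.
rewrite succnK.
have -> : act (spow (transition true) (n.+1 + n)) X3 = X3.
  by rewrite addSn act_spow iter_X3.
have long_x q : q = X3 \/ q = Y2 ->
    act (spow (transition true) (n.+1 + 2)) q = X3.
  by rewrite addn2 act_spow !iterSr !act_transition => -[] ->; exact: iter_X3.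
have long_y : act (spow (transition false) (n.+1 + 1)) X3 = Y2.
  by rewrite addn1 act_spow !iterSr !act_transition iter_Y2.
set c := spow _ _ * spow _ _.
have cE q : q = X3 \/ q = Y2 -> act c q = Y2.
  by move=> qE; rewrite actM long_x.
have -> : act (spow c (n.+1 + n)) X3 = Y2.
  rewrite addSn act_spow.
  elim: (n + n) => [|m IH]; first by rewrite /= cE; last left.
  by rewrite iterS IH cE; last right.
by rewrite long_x; last right.
Qed.

(** * Non-reducibility *)

Lemma short_run_final q r : size r <= 2 -> run q r = E3 -> final q.
Proof.
by case: r => [|a [|b []]] //= _; case: q => //; case: a => //; case: b.
Qed.

(** The infinite exponent serves to exclude members of [sigma] that are words of
    length less than 4. *)
Lemma operation_avoids_final (sigma : set (pseudoword bool)) :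
  infinite_exponent (H_ sigma) -> sigma !=set0 ->
  forall w, sigma w ->
    (is_suffix [:: true; true; true] (Some w) \/
     is_suffix [:: false; false; false] (Some w)) \/
    (forall v : seq bool, size v = 4 -> factor_near_end v (Some w) ->
       two_disjoint_occurrences v (Some w)) ->
  forall psi, (forall b, wordlike (psi b)) -> avoids_final (interp w psi).
Proof.
move=> infexp sigma_neq0 w sw [[suf|suf]|rep] psi psiW;
  try exact: cube_suffix_avoids_final suf.
have [[a [s [_ Ew]]]|[v [sv Ev]]] := pseudoword_suffix 4 w.
  have [G [e [g [HG _ eP]]]] :=
    infinite_exponent_cyclic sigma_neq0 infexp (ltn0Sn (size s)).
  rewrite -spow_pow // -(interp_word_const a) -Ew; case.
  exact: identity_unique (H_interp _ HG sw) eP.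
apply: (repeated_suffix_avoids_final psiW _ Ev); first by rewrite sv.
apply: rep => //; exists v; split=> //.
by exists None, None; rewrite mul1None.
Qed.

Theorem theorem7 (sigma : set (pseudoword bool)) :
  sigma !=set0 ->
  (forall w, sigma w ->
     (is_suffix [:: true; true; true] (Some w) \/
      is_suffix [:: false; false; false] (Some w)) \/
     (forall v : seq bool, size v = 4 -> factor_near_end v (Some w) ->
        two_disjoint_occurrences v (Some w))) ->
  infinite_exponent (H_ sigma) ->
  forall V : set finSemigroupType, pseudovariety V ->
    H_ sigma `&` Ab `<=` V -> V `<=` CR (H_ sigma) ->
    ~ reducible V (sigma_omega sigma).
Proof.
move=> sigma_neq0 sigmaP infexp V _ HV VCR red.
have shape := tau_word_shape sigma_neq0 (fun w sw =>
  operation_avoids_final infexp sigma_neq0 sw (sigmaP w sw)).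
pose S := generated true transition : finSemigroupType.
pose eta (w : pseudoword bool) : S :=
  interp w (@generator bool true _ transition).
have val_eta w : val (eta w) = interp w transition.
  by rewrite (@interp_natural _ w S transformation val).
pose v0 : pseudoword bool := letter true * letter false.
have [||||u [v [/shape[m [Eu Su]] /shape[n [Ev Sv]] [Vuv eta_u eta_v]]]] :=
  red bool S eta _ _ _ (eta long_solution) (eta v0).
- by [].
- exact: interp_continuous.
- move=> s; have /asboolP[a [t Es]] := valP s.
  by exists (word a t); apply: val_inj; rewrite val_eta.
- exists long_solution, v0; split=> // T VT.
  exact/CR_long_solution/(VCR T VT).1.
have act_u : act (interp u transition) X3 = E3.
  by rewrite -val_eta eta_u val_eta act_long_solution.
have act_v : act (interp v transition) E1 = E3.
  by rewrite -val_eta eta_v val_eta interpM actM !act_transition.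
(* From [E1] to [E3] there is only the word [xy]; a value of an operation would
   lead from [E1] to [Dead]. *)
have n2 : n = 2.
  case: Sv => [[a [s [Es ->]]]|[p [w [r [Ew avw _]]]]].
    by move: act_v; rewrite Es act_word; case: s {Es} => [|b [|c s]];
      [case: a|case: a; case: b|rewrite late_dead].
  move: act_v; rewrite -[act _ _]/(act1 transition (Some v) E1) Ew !act1M.
  set q := act1 _ (Some w) _.
  have : late q by do 2!apply: (late_act1 transition_wordlike).
  have : ~~ final q by exact: avw.
  have [t [_ ->]] := acts_as_word1 transition_wordlike r.
  by case: q => // _ _; elim: t.
(* If at most two letters followed the last value of an operation, this value
   would lead to [E1], [E2] or [E3]. *)
have m3 : 2 < m.
  case: Su => [[a [s [Es ->]]]|[p [w [r [Ew avw ler]]]]].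
    move: act_u; rewrite Es act_word; case: s {Es} => [|b [|c s]] //;
      by case: a => //; case: b.
  apply: leq_trans ler; rewrite ltnNge; apply/negP => ler.
  move: act_u; rewrite -[act _ _]/(act1 transition (Some u) X3) Ew !act1M.
  set q := act1 _ (Some w) _ => run_r.
  have : ~~ final q by exact: avw.
  rewrite (short_run_final ler) // -run_r.
  by case: (r) => //= a s; rewrite act_word.
have [G [e [g [HG AbG eP gm]]]] :
  exists (G : finSemigroupType) (e g : G),
    [/\ H_ sigma G, Ab G, is_identity e & pow e g (m - 2) <> e].
  by apply: infinite_exponent_cyclic; rewrite ?subn_gt0.
have VG : V G by exact: HV.
apply: gm; have := Vuv G VG (fun=> g).
rewrite (Eu G HG e) // (Ev G HG e) // n2.
rewrite -[in pow e g m](subnK (ltnW m3)) powD //.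
move: (pow e g _) (pow e g 2) => c d Ecd.
have [e' [e'P inv]] := AbG.1; have [d' [_ dd']] := inv d.
have e'e : e' = e by apply: identity_unique eP.
by rewrite -[c](eP _).2 -e'e -dd' mulgA Ecd.
Qed.
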